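(* Let $(J_n)_{n\ge0}$ be the Jacobsthal numbers. For each tuple $(a,b,c,d)$ below, the set of triples $(x,y,z)=(J_i,J_j,J_k)$ with integers $i,j,k\ge1$ satisfying $ax^2+by^2+cz^2=dxyz$ is exactly the following: - $(1,1,1,1)$: $\{(3,3,3)\}$; - $(1,1,1,3)$: $\{(1,1,1)\}$; - $(1,1,2,2)$: no solutions; - $(1,1,2,4)$: $\{(1,1,1),(1,3,1),(1,3,5),(3,1,1),(3,1,5),(3,11,1),(11,3,1)\}$; - $(1,1,5,5)$: $\{(1,3,1),(3,1,1)\}$; - $(1,2,3,6)$: $\{(1,1,1),(5,1,1)\}$.
   Context: The Jacobsthal numbers are defined by $J_0=0$, $J_1=1$, $J_n=J_{n-1}+2J_{n-2}$ for $n\ge2$; equivalently $J_n=\frac{2^n-(-1)^n}{3}$. *)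

(* Defs.v *)
From mathcomp Require Import all_boot.

Fixpoint jacobsthal (n : nat) : nat :=
  if n is n1.+1 then
    if n1 is n2.+1 then jacobsthal n1 + 2 * jacobsthal n2 else 1
  else 0.

(* A solution is a triple of values: distinct index triples (i, j, k) may give
   the same solution, since jacobsthal 1 = jacobsthal 2 = 1. *)
Definition jacobsthal_solution (a b c d : nat) (t : nat * nat * nat) : Prop :=
  let: (x, y, z) := t in
  (exists i j k : nat,
      [/\ 1 <= i, 1 <= j & 1 <= k] /\
      [/\ x = jacobsthal i, y = jacobsthal j & z = jacobsthal k]) /\
  a * x ^ 2 + b * y ^ 2 + c * z ^ 2 = d * x * y * z.

Definition jacobsthal_solution_set (a b c d : nat)
    (s : seq (nat * nat * nat)) : Prop :=
  forall t : nat * nat * nat, jacobsthal_solution a b c d t <-> t \in s.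

(* Main.v *)
From Stdlib Require Import NArith.
Require Import Defs.
From mathcomp Require Import all_boot.

(** Since J_(n+2) = J_n + 2^n, modulo 2^M the sequence has period 2 from index
    M on. If all three indices are large, then 3 J_n = 2^n - (-1)^n turns the
    equation into the congruence 3 (a + b + c) = ± d modulo a large power of 2,
    which fails; the same happens, with other nonzero constants, when one or two
    of the indices are small. Hence for a suitable M (at most 11 for these six
    tuples) every solution modulo 2^M with indices in [1, M + 1] has its indices
    below M, and these finitely many triples can be enumerated. *)

Lemma jacobsthal_addS n : jacobsthal n + jacobsthal n.+1 = 2 ^ n.
Proof.
elim: n => [//|n IHn]; rewrite expnS -IHn.
have -> : jacobsthal n.+2 = jacobsthal n.+1 + 2 * jacobsthal n by [].
by rewrite mulnDr addnA addnn -mul2n addnC.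
Qed.

Lemma jacobsthal_SS n : jacobsthal n.+2 = jacobsthal n + 2 ^ n.
Proof. by rewrite -jacobsthal_addS addnA addnn -mul2n addnC. Qed.

(** Indices from [M] on collapse to [M] or [M + 1], one per residue class of the period; smaller
    ones stay fixed, so a representative below [M] determines its index. *)
Definition jacobsthal_rep (M n : nat) : nat :=
  if n < M then n else M + odd (n - M).

Lemma jacobsthal_rep_mod M n :
  jacobsthal (jacobsthal_rep M n) = jacobsthal n %[mod 2 ^ M].
Proof.
rewrite /jacobsthal_rep; case: ltnP => // /subnKC {2}<-.
(* Induction on the number of steps of two above the representative: each adds a power of 2 with
   exponent at least [M]. *)
rewrite -{2}(odd_double_half (n - M)) addnA.
elim: (n - M)./2 => [|m IHm]; first by rewrite addn0.
rewrite doubleS !addnS jacobsthal_SS IHm [in RHS]addnC.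
by rewrite -[in 2 ^ (_ + _)](addnA M) expnD mulnC modnMDl.
Qed.

Lemma jacobsthal_rep_range M n :
  0 < M -> 0 < n -> jacobsthal_rep M n \in iota 1 M.+1.
Proof.
rewrite mem_iota /jacobsthal_rep => M_gt0 n_gt0.
case: (ltnP n M) => [ltnM | _].
  by apply/andP; split=> //; rewrite add1n !leqW.
apply/andP; split; first by rewrite addn_gt0 M_gt0.
by rewrite add1n ltnS -addn1 leq_add2l; case: odd.
Qed.

Lemma jacobsthal_rep_id M n : jacobsthal_rep M n < M -> jacobsthal_rep M n = n.
Proof.
by rewrite /jacobsthal_rep; case: (ltnP n M) => // _; rewrite ltnNge leq_addr.
Qed.

Lemma eqn_modD p m m' n n' :
  m = m' %[mod p] -> n = n' %[mod p] -> m + n = m' + n' %[mod p].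
Proof. by move=> eq_m eq_n; rewrite -modnDm eq_m eq_n modnDm. Qed.

Lemma eqn_modM p m m' n n' :
  m = m' %[mod p] -> n = n' %[mod p] -> m * n = m' * n' %[mod p].
Proof. by move=> eq_m eq_n; rewrite -modnMm eq_m eq_n modnMm. Qed.

(** By Euclidean division both numbers are a multiple of [p] plus the same remainder, a form that
    [N.of_nat] preserves. *)
Lemma of_nat_modn (m n p : nat) :
  m = n %[mod p] ->
  (N.of_nat m mod N.of_nat p)%num = (N.of_nat n mod N.of_nat p)%num.
Proof.
move=> eq_mn; rewrite (divn_eq m p) (divn_eq n p) eq_mn.
rewrite !Nat2N.inj_add !Nat2N.inj_mul ![N.add (N.mul _ _) _]N.add_comm.
by rewrite !N.Div0.mod_add.
Qed.

(* Binary arithmetic keeps the evaluation of the congruence cheap. *)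
Definition markov_mod (M a b c d x y z : nat) : bool :=
  let: (a, b, c, d) := (N.of_nat a, N.of_nat b, N.of_nat c, N.of_nat d) in
  let: (x, y, z) := (N.of_nat x, N.of_nat y, N.of_nat z) in
  let m := N.of_nat (2 ^ M) in
  N.eqb ((a * (x * x) + b * (y * y) + c * (z * z)) mod m)%num
        ((d * x * y * z) mod m)%num.

Lemma markov_modP M a b c d x y z :
  a * x ^ 2 + b * y ^ 2 + c * z ^ 2 = d * x * y * z %[mod 2 ^ M] ->
  markov_mod M a b c d x y z.
Proof.
move=> /of_nat_modn; rewrite /markov_mod -!mulnn.
by rewrite !Nat2N.inj_add !Nat2N.inj_mul => /N.eqb_eq.
Qed.

(* The test is a conditional, not an implication: under call-by-value
   evaluation [==>] would compute the membership test for every triple. *)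
Definition markov_sieve (M a b c d : nat) (s : seq (nat * nat * nat)) : bool :=
  let r := [seq (i, jacobsthal i) | i <- iota 1 M.+1] in
  all (fun p => all (fun q => all (fun t =>
    if markov_mod M a b c d p.2 q.2 t.2 then
      [&& p.1 < M, q.1 < M, t.1 < M & (p.2, q.2, t.2) \in s]
    else true) r) r) r.

(** Bounding the indices by [M] turns their existence into a finite search, so listed triples can be
    verified by computation. *)
Definition jacobsthal_triple_check (M a b c d : nat) (t : nat * nat * nat) :=
  let: (x, y, z) := t in
  let r := [seq jacobsthal i | i <- iota 1 M] in
  [&& x \in r, y \in r, z \in r &
      a * x ^ 2 + b * y ^ 2 + c * z ^ 2 == d * x * y * z].

Lemma jacobsthal_triple_checkP M a b c d t :
  jacobsthal_triple_check M a b c d t -> jacobsthal_solution a b c d t.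
Proof.
case: t => [[x y] z] /and4P[].
move=> /mapP[i + ->] /mapP[j + ->] /mapP[k + ->] /eqP eq_xyz.
rewrite !mem_iota => /andP[i_gt0 _] /andP[j_gt0 _] /andP[k_gt0 _].
by split=> //; exists i, j, k.
Qed.

Lemma jacobsthal_solution_set_sieve M a b c d s :
  0 < M -> markov_sieve M a b c d s ->
  all (jacobsthal_triple_check M a b c d) s ->
  jacobsthal_solution_set a b c d s.
Proof.
move=> M_gt0 sieve /allP check t; split; last first.
  by move=> /check /jacobsthal_triple_checkP.
case: t => [[x y] z] [[i [j [k [[i_gt0 j_gt0 k_gt0] [-> -> ->]]]]] eq_ijk].
have rep n : 0 < n -> (jacobsthal_rep M n, jacobsthal (jacobsthal_rep M n))
    \in [seq (i, jacobsthal i) | i <- iota 1 M.+1].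
  by move=> n_gt0; apply: map_f; apply: jacobsthal_rep_range.
have := allP (allP (allP sieve _ (rep i i_gt0)) _ (rep j j_gt0)) _ (rep k k_gt0).
(* Once the congruence, left as a side goal, holds for the representatives, the sieve puts them
   below [M], where they equal [i], [j], [k]. *)
rewrite /= markov_modP.
  by case/and4P=> /jacobsthal_rep_id-> /jacobsthal_rep_id-> /jacobsthal_rep_id->.
have rep_mod n := jacobsthal_rep_mod M n.
transitivity ((a * jacobsthal i ^ 2 + b * jacobsthal j ^ 2
               + c * jacobsthal k ^ 2) %% 2 ^ M).
  by do ![apply: eqn_modD | apply: eqn_modM | apply: rep_mod].
by rewrite eq_ijk; do ![apply: eqn_modM | symmetry; apply: rep_mod].
Qed.

Theorem theorem5 :
  jacobsthal_solution_set 1 1 1 1 [:: (3, 3, 3)] /\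
  jacobsthal_solution_set 1 1 1 3 [:: (1, 1, 1)] /\
  jacobsthal_solution_set 1 1 2 2 [::] /\
  jacobsthal_solution_set 1 1 2 4
    [:: (1, 1, 1); (1, 3, 1); (1, 3, 5); (3, 1, 1); (3, 1, 5);
        (3, 11, 1); (11, 3, 1)] /\
  jacobsthal_solution_set 1 1 5 5 [:: (1, 3, 1); (3, 1, 1)] /\
  jacobsthal_solution_set 1 2 3 6 [:: (1, 1, 1); (5, 1, 1)].
Proof.
split; first by apply: (@jacobsthal_solution_set_sieve 6); vm_compute.
split; first by apply: (@jacobsthal_solution_set_sieve 7); vm_compute.
(* Modulo 8 there is no solution at all: with [x], [y], [z] odd, the left side is 4 modulo 8 and the
   right side is 2 modulo 4. *)
split; first by apply: (@jacobsthal_solution_set_sieve 3); vm_compute.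
split; first by apply: (@jacobsthal_solution_set_sieve 8); vm_compute.
split; first by apply: (@jacobsthal_solution_set_sieve 11); vm_compute.
by apply: (@jacobsthal_solution_set_sieve 7); vm_compute.
Qed.
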